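(* Let $\mu$ be a distribution on $\{0,1\}^{\mathbb{N}}$, let $X=(X_i)_{i\in\mathbb{N}}\sim\mu$ be defined on a probability space $(\Omega,\mathcal{F},\mathbb{P})$, and suppose $(\mathbb{N},\xi)$ is totally bounded. Suppose there exists $K\ge1$ such that for every $\varepsilon>0$ there exist events $(E_k)_{k\in\mathbb{N}}$ in $\mathcal{F}$ and a finite set $J\subset\mathbb{N}$ with: (1) $\mathbb{P}(E_k)\le\varepsilon$ for all $k\in\mathbb{N}$; (2) $\sup_{k\in\mathbb{N}}\frac{\log(k+1)}{\log(1/\mathbb{P}(E_k))}<\infty$; (3) for every $i\in\mathbb{N}$ there exist $j\in J$ and $\mathcal{K}\subset\mathbb{N}$ with $|\mathcal{K}|\le K$ and $\{X_i\neq X_j\}\subset\bigcup_{k\in\mathcal{K}}E_k$. Then $\Delta_n(\mu)\to0$ as $n\to\infty$.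
   Context: $\xi(i,j):=\mathbb{P}(X_i\neq X_j)$ for $i,j\in\mathbb{N}$; $(\mathbb{N},\xi)$ is totally bounded if for every $\varepsilon>0$ there is a finite $S\subset\mathbb{N}$ such that every $i$ has $s\in S$ with $\xi(i,s)\le\varepsilon$. For $n\ge1$, with $X^{(1)},\dots,X^{(n)}$ i.i.d. from $\mu$, $\Delta_n(\mu):=\mathbb{E}\sup_{j\in\mathbb{N}}\left|\frac1n\sum_{i=1}^nX^{(i)}_j-\mathbb{E}[X_j]\right|$. In (2), $\log(1/0)=\infty$. *)

(* Defs.v *)
From HB Require Import structures.
From mathcomp Require Import all_boot all_order all_algebra.
From mathcomp Require Import all_classical all_reals all_analysis.
Set Implicit Arguments. Unset Strict Implicit. Unset Printing Implicit Defensive.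
Import Order.TTheory GRing.Theory Num.Theory.
Local Open Scope classical_set_scope.
Local Open Scope ring_scope.

Definition prb {R : realType} {d} {T : measurableType d}
  (P : probability T R) (A : set T) : R := fine (P A).

Definition cyl_measurable : set (set (nat -> bool)) :=
  <<s \bigcup_(j in [set: nat])
        preimage_set_system [set: nat -> bool] (fun f : nat -> bool => f j)
          (@measurable _ bool) >>.

Definition vec {T : Type} (X : nat -> T -> bool) : T -> (nat -> bool) :=
  fun w j => X j w.

Definition xi {R : realType} {d} {T : measurableType d}
  (P : probability T R) (X : nat -> T -> bool) (i j : nat) : R :=
  prb P [set w | X i w != X j w].

Definition totally_bounded_xi {R : realType} {d} {T : measurableType d}
  (P : probability T R) (X : nat -> T -> bool) : Prop :=
  forall eps : R, 0 < eps ->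
    exists S : seq nat, forall i : nat, exists2 s, s \in S & xi P X i s <= eps.

Definition same_law {R : realType} {d} {T : measurableType d}
  (P : probability T R) (X : nat -> T -> bool)
  {d'} {T' : measurableType d'} (P' : probability T' R) (Y : T' -> nat -> bool)
  : Prop :=
  forall A, cyl_measurable A -> P' (Y @^-1` A) = P (vec X @^-1` A).

Definition mutually_independent {R : realType} {d'} {T' : measurableType d'}
  (P' : probability T' R) (Y : nat -> T' -> nat -> bool) : Prop :=
  forall (I : seq nat) (A : nat -> set (nat -> bool)),
    uniq I -> (forall i, i \in I -> cyl_measurable (A i)) ->
    prb P' (\bigcap_(i in [set i | i \in I]) (Y i @^-1` A i))
      = \prod_(i <- I) prb P' (Y i @^-1` A i).

Definition iid_samples {R : realType} {d} {T : measurableType d}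
  (P : probability T R) (X : nat -> T -> bool)
  {d'} {T' : measurableType d'} (P' : probability T' R)
  (Y : nat -> T' -> nat -> bool) : Prop :=
  [/\ forall i j, measurable_fun [set: T'] (fun w => Y i w j),
      forall i, same_law P X P' (Y i) &
      mutually_independent P' Y].

Definition meanX {R : realType} {d} {T : measurableType d}
  (P : probability T R) (X : nat -> T -> bool) (j : nat) : R :=
  prb P [set w | X j w].

Definition Delta {R : realType} {d} {T : measurableType d}
  (P : probability T R) (X : nat -> T -> bool)
  {d'} {T' : measurableType d'} (P' : probability T' R)
  (Y : nat -> T' -> nat -> bool) (n : nat) : \bar R :=
  (\int[P']_w ereal_sup [set (`| n%:R^-1 * (\sum_(i < n) ((Y i w j : nat)%:R))
                                  - meanX P X j |)%:E | j in [set: nat]])%E.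

(* Main.v *)
Require Import Defs.
From HB Require Import structures.
From mathcomp Require Import all_boot all_order all_algebra.
From mathcomp Require Import all_classical all_reals all_analysis.
From mathcomp Require Import measurable_realfun ring lra.
Import Order.TTheory GRing.Theory Num.Theory.
Local Open Scope classical_set_scope.
Local Open Scope ring_scope.

(** The events E_k live on Omega while the samples only see the law of X, so
    each E_k is first replaced by a cylinder set B_k, which plays the role of
    {P(E_k | X) >= 1/(2K)}: a Hahn decomposition of 2K P(E_k /\ .) - P gives
    P(X in B_k) <= 2K P(E_k), and an event of sigma(X) covered by at most K of
    the E_k is almost surely covered by the corresponding B_k.
    Fix M. By condition (2) and for small eps, a union bound over k shows that
    with probability 1 - O(1/n) no B_k is hit by more than n/M of the n samples,
    and Chebyshev's inequality controls the finitely many coordinates j in J.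
    Comparing the coordinate i with its j in J, the empirical means differ by at
    most K/M and the true ones by at most K eps. *)

(** The generators of [cyl_measurable], named so that [g_sigma_algebraType cylinders] can serve as
    the target space of the sample maps. *)
Definition cylinders : set (set (nat -> bool)) :=
  \bigcup_(j in [set: nat])
    preimage_set_system [set: nat -> bool] (fun f : nat -> bool => f j)
      (@measurable _ bool).

(** * Real-valued probabilities and union bounds *)

Section prb_theory.
Context {R : realType} {d} {T : measurableType d} (P : probability T R).
Implicit Types A B : set T.

Lemma EFin_prb A : measurable A -> (prb P A)%:E = P A.
Proof. by move=> mA; rewrite /prb fineK ?fin_num_measure. Qed.

Lemma prb_ge0 A : 0 <= prb P A.
Proof. by rewrite /prb fine_ge0. Qed.

Lemma prb_le1 A : measurable A -> prb P A <= 1.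
Proof. by move=> mA; rewrite -lee_fin EFin_prb// probability_le1. Qed.

Lemma le_prb A B : measurable A -> measurable B -> A `<=` B ->
  prb P A <= prb P B.
Proof.
by move=> mA mB AB; rewrite -lee_fin !EFin_prb// le_measure ?inE.
Qed.

(** By induction on the list: the part of [A] inside [F i] is bounded through [F i], and the rest of
    [A] is covered by the remaining events. *)
Lemma prb_sub_bigcup_seq (I : choiceType) (s : seq I) (F : I -> set T) A :
  measurable A -> (forall i, measurable (F i)) ->
  A `<=` \bigcup_(i in [set i | i \in s]) F i ->
  prb P A <= \sum_(i <- s) prb P (F i).
Proof.
move=> mA mF.
elim: s A mA => [|i s IH] A mA AF.
  rewrite big_nil [A](_ : _ = set0) ?/prb ?measure0//.
  by rewrite -subset0 => x /AF[].
rewrite big_cons.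
have mAi : measurable (A `&` F i) by exact: measurableI.
have mAD : measurable (A `\` F i) by exact: measurableD.
rewrite -lee_fin EFinD EFin_prb//.
rewrite -[in leLHS](setUIDK A (F i)) measureU//=; last first.
  by rewrite setDE setIACA setICr setI0.
rewrite -!EFin_prb// -!EFinD lee_fin lerD//.
  by apply: le_prb => // x [].
apply: IH => // x [Ax nFx]; have [j /= + Fj] := AF _ Ax.
rewrite inE => /orP[/eqP ji|js]; last by exists j.
by rewrite ji in Fj.
Qed.

Lemma prb_setU_le A B : measurable A -> measurable B ->
  prb P (A `|` B) <= prb P A + prb P B.
Proof.
move=> mA mB; rewrite -lee_fin EFinD !EFin_prb//; last exact: measurableU.
exact: measureU2.
Qed.

Lemma dist_prb_le A B C : measurable A -> measurable B -> measurable C ->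
  A `<=` B `|` C -> B `<=` A `|` C -> `|prb P A - prb P B| <= prb P C.
Proof.
move=> mA mB mC ABC BAC; rewrite ler_distl; apply/andP; split.
  rewrite lerBlDr; apply: le_trans (prb_setU_le _ _ mA mC).
  by apply: le_prb => //; exact: measurableU.
apply: le_trans (prb_setU_le _ _ mB mC).
by apply: le_prb => //; exact: measurableU.
Qed.

Lemma prb_bigcup_le (F : nat -> set T) (c : R) :
  (forall k, measurable (F k)) ->
  (forall N, \sum_(k < N) prb P (F k) <= c) ->
  prb P (\bigcup_k F k) <= c.
Proof.
move=> mF Fc.
have mU : measurable (\bigcup_k F k) by exact: bigcup_measurable.
rewrite -lee_fin EFin_prb//.
apply: (le_trans (generalized_Boole_inequality _ _ _)) => //.
apply: lime_le; first exact: is_cvg_nneseries.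
apply: nearW => N; rewrite big_mkord.
rewrite (_ : (\sum_(k < N) P (F k))%E = (\sum_(k < N) prb P (F k))%:E) ?lee_fin//.
by rewrite -sumEFin; apply: eq_bigr => k _; rewrite EFin_prb.
Qed.

Lemma prb_bigcup0 (F : nat -> set T) :
  (forall k, measurable (F k)) -> (forall k, prb P (F k) = 0) ->
  prb P (\bigcup_k F k) = 0.
Proof.
move=> mF F0; apply/eqP; rewrite eq_le prb_ge0 andbT.
by apply: prb_bigcup_le => // N; rewrite big1.
Qed.

End prb_theory.

(** * Replacing events of the source space by events seen through a map *)

Section hahn_trace.
Context {R : realType} {d d'} {T : measurableType d} {T' : measurableType d'}.
Context (P : probability T R).

(** [B] is the positive set of a Hahn decomposition of c P(E /\ f^-1 .) - P(f^-1 .), and the two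
    inequalities are the signs of this charge inside and outside [B]. For c > 0, [B] plays the role
    of {P(E | f) >= 1/c}. *)
Lemma exists_trace (f : T -> T') (E : set T) (c : R) :
  measurable_fun setT f -> measurable E ->
  exists B : set T', [/\ measurable B,
    forall D, measurable D -> D `<=` B ->
      prb P (f @^-1` D) <= c * prb P (E `&` f @^-1` D) &
    forall D, measurable D -> D `&` B = set0 ->
      c * prb P (E `&` f @^-1` D) <= prb P (f @^-1` D)].
Proof.
move=> mf mE.
pose nu0 := charge_of_finite_measure P.
pose nu1 := cadd (cscale c (crestr0 nu0 mE)) (cscale (-1) nu0).
(* The charge is pushed forward before it is decomposed, so that the positive set is a set of [T']
   and not merely of [T]. *)
have [nu nuP] : exists nu : {charge set T' -> \bar R},
    nu = pushforward nu1 f :> (set T' -> \bar R).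
  by unshelve (eexists; reflexivity).
have [B [N [[mB posB] [mN negN] BN BN0]]] := Hahn_decomposition nu.
have nuE D : measurable D ->
    nu D = (c * prb P (E `&` f @^-1` D) - prb P (f @^-1` D))%:E.
  move=> mD; have mfD : measurable (f @^-1` D).
    by rewrite -[X in measurable X]setTI; exact: mf.
  rewrite nuP /pushforward /nu1 /cadd /= /cscale /= /crestr0 mem_set//.
  rewrite /crestr /nu0 /charge_of_finite_measure setIC.
  by rewrite -!EFin_prb// ?EFinB//; [rewrite mulN1e|exact: measurableI].
exists B; split => // D mD DB.
  by have := posB D mD DB; rewrite nuE// lee_fin subr_ge0.
have DN : D `<=` N.
  move=> x Dx; have : (B `|` N) x by rewrite BN.
  case=> // Bx; exfalso; have : (D `&` B) x by split.
  by rewrite DB.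
by have := negN D mD DN; rewrite nuE// lee_fin subr_le0.

Qed.

(** Apply [exists_trace] with c = 2K. On the uncovered part N of [D], each E_k with k in [Ks] has
    P(E_k /\ f^-1 N) <= P(f^-1 N) / 2K. At most K of these events cover f^-1 N, so P(f^-1 N) is at
    most half of itself and vanishes. *)
Lemma exists_traces (f : T -> T') (E : nat -> set T) (K : nat) :
  measurable_fun setT f -> (forall k, measurable (E k)) -> (0 < K)%N ->
  exists B : nat -> set T', [/\ forall k, measurable (B k),
    forall k, prb P (f @^-1` B k) <= (2 * K)%:R * prb P (E k) &
    forall D (Ks : seq nat), measurable D -> (size Ks <= K)%N ->
      f @^-1` D `<=` \bigcup_(k in [set k | k \in Ks]) E k ->
      prb P (f @^-1` (D `\` \bigcup_(k in [set k | k \in Ks]) B k)) = 0].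
Proof.
move=> mf mE K0.
have mfI D : measurable D -> measurable (f @^-1` D).
  by move=> mD; rewrite -[X in measurable X]setTI; exact: mf.
have /choice[B traceB] := fun k => @exists_trace f (E k) (2 * K)%:R mf (mE k).
have mB k : measurable (B k) by have [] := traceB k.
exists B; split => // [k|D Ks mD sK DE].
  have [_ + _] := traceB k => /(_ (B k) (mB k) (@subset_refl _ _)) /le_trans; apply.
  rewrite ler_wpM2l// le_prb//.
  by apply: measurableI => //; exact: mfI.
set N := D `\` _.
have mN : measurable N.
  by apply: measurableD => //; apply: bigcup_measurable => k _.
have mfN := mfI _ mN.
have EN k : k \in Ks -> (2 * K)%:R * prb P (E k `&` f @^-1` N) <= prb P (f @^-1` N).
  move=> kKs; have [_ _] := traceB k; apply => //.
  by rewrite -subset0 => x [[_ nBx] Bx]; apply: nBx; exists k.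
have mEN k : measurable (E k `&` f @^-1` N) by exact: measurableI.
have le_sum : prb P (f @^-1` N) <= \sum_(k <- Ks) prb P (E k `&` f @^-1` N).
  apply: prb_sub_bigcup_seq => // x Nx.
  by have [k kKs Ekx] := DE _ Nx.1; exists k.
have : (2 * K)%:R * prb P (f @^-1` N) <= K%:R * prb P (f @^-1` N).
  apply: (le_trans (ler_wpM2l _ le_sum)) => //.
  rewrite mulr_sumr big_seq (le_trans (ler_sum _ EN))// -big_seq.
  rewrite big_const_seq count_predT iter_addr addr0 -[leLHS]mulr_natl.
  by rewrite ler_wpM2r ?prb_ge0// ler_nat.
rewrite mul2n -addnn natrD mulrDl gerDl pmulr_rle0 ?ltr0n// => fN0.
by apply/eqP; rewrite eq_le fN0 prb_ge0.
Qed.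
End hahn_trace.

(** * Independent events of equal probability: counting hits *)

Section iid_events.
Context {R : realType} {d} {T : measurableType d} (P : probability T R).

(** For events, the product formula over all finite sets of indices is mutual independence; [uniq]
    makes [size I] count distinct events. *)
Definition iid_events (q : R) (A : nat -> set T) :=
  (forall i, measurable (A i)) /\
  forall I : seq nat, uniq I ->
    prb P (\bigcap_(i in [set i | i \in I]) A i) = q ^+ size I.

Lemma iid_events1 q A i : iid_events q A -> prb P (A i) = q.
Proof.
move=> [_ /(_ [:: i] isT)]; rewrite expr1 => <-; congr prb.
by apply/seteqP; split=> [x Ax j /=|x]; [rewrite inE => /eqP ->|apply => /=; rewrite inE].
Qed.

Lemma iid_events2 q A i j : iid_events q A -> i != j ->
  prb P (A i `&` A j) = q ^+ 2.
Proof.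
move=> [_ /(_ [:: i; j])] /= + ij; rewrite inE ij => /(_ isT) <-; congr prb.
apply/seteqP; split=> [x [Ai Aj] k /=|x Ax].
  by rewrite !inE => /orP[] /eqP ->.
by split; apply: Ax; rewrite /= !inE eqxx ?orbT.
Qed.

(** If there are [m] hits, the set of all hit indices has at least [m] elements. A union bound over
    at most 2^n such sets S, each of probability q^|S| <= q^m, gives the estimate. The crude factor
    2^n is harmless later, where q <= 2^-(M+1) and n <= M m. *)
Lemma prb_many_hits q A (n m : nat) : iid_events q A -> 0 <= q <= 1 ->
  let hits w := (\sum_(i < n) (w \in A i))%N in
  measurable [set w | (m <= hits w)%N] /\
  prb P [set w | (m <= hits w)%N] <= 2 ^+ n * q ^+ m.
Proof.
move=> [mA indA] /andP[q0 q1] hits.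
pose idx (S : {set 'I_n}) := [seq val i | i <- enum S].
pose F (S : {set 'I_n}) := \bigcap_(i in [set i | i \in idx S]) A i.
have mF S : measurable (F S) by exact: fin_bigcap_measurable.
have hitsE : [set w | (m <= hits w)%N] =
    \bigcup_(S in [set S : {set 'I_n} | (m <= #|S|)%N]) F S.
  apply/seteqP; split=> [w /= mw|w [S /= mS FS]].
    exists [set i : 'I_n | w \in A i]%SET.
      by rewrite /= (leq_trans mw)// /hits -big_mkcond sum1dep_card.
    by move=> _ /= /mapP[i + ->]; rewrite mem_enum inE => /set_mem.
  rewrite (leq_trans mS)// /hits -big_mkcond sum1dep_card.
  apply/subset_leq_card/fintype.subsetP => i iS; rewrite inE; apply/mem_set/FS.
  by apply/mapP; exists i; rewrite ?mem_enum.
have mhits : measurable [set w | (m <= hits w)%N].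
  rewrite hitsE; apply: fin_bigcup_measurable => // S _; exact: mF.
split => //.
have /(prb_sub_bigcup_seq _ _ _ _ _ mhits mF)/le_trans : [set w | (m <= hits w)%N] `<=`
    \bigcup_(S in [set S | S \in enum [pred S : {set 'I_n} | (m <= #|S|)%N]]) F S.
  by rewrite hitsE => w [S mS FS]; exists S => //=; rewrite mem_enum.
apply; rewrite big_enum/=.
apply: (@le_trans _ _ (\sum_(S : {set 'I_n} | (m <= #|S|)%N) q ^+ m)).
  apply: ler_sum => S mS; rewrite indA; last first.
    by rewrite map_inj_uniq ?enum_uniq//; exact: val_inj.
  by rewrite size_map -cardE ler_wiXn2l.
apply: (@le_trans _ _ (\sum_(S : {set 'I_n}) q ^+ m)).
  rewrite [leRHS](bigID (fun S : {set 'I_n} => (m <= #|S|)%N))/= lerDl.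
  by rewrite sumr_ge0// => S _; rewrite exprn_ge0.
by rewrite sumr_const -cardsT -powersetT card_powerset cardsT card_ord -[leLHS]mulr_natl natrX.
Qed.

End iid_events.

(** * Chebyshev's inequality through combinations of indicators *)

Section weak_law.
Context {R : realType} {d} {T : measurableType d} (P : probability T R).

(** A finite combination of indicators is coded as a list of pairs of a coefficient and an event.
    With nonnegative coefficients, a pointwise inequality integrates to one between probabilities
    without any integrability condition. *)
Let nonneg_comb (s : seq (R * set T)) :=
  forall p, p \in s -> 0 <= p.1 /\ measurable p.2.

Lemma measurable_comb_indic (s : seq (R * set T)) : nonneg_comb s ->
  measurable_fun setT (fun w => \sum_(p <- s) p.1 * \1_(p.2) w : R).
Proof.
move=> hs; rewrite (_ : (fun w => _) = fun w => \sum_(p <- s)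
    (if p \in s then p.1 * \1_(p.2) w else 0)); last first.
  by apply/funext => w; rewrite big_seq [RHS]big_seq; apply: eq_bigr => p ->.
apply: measurable_sum => p; have [/hs[_ mp]|_ //] := boolP (p \in s).
by apply: measurable_funM => //; exact: measurable_indic.
Qed.

Lemma integral_comb_indic (s : seq (R * set T)) : nonneg_comb s ->
  (\int[P]_w (\sum_(p <- s) p.1 * \1_(p.2) w)%:E)%E =
    (\sum_(p <- s) p.1 * prb P p.2)%:E.
Proof.
elim: s => [|[a A] s IH] hs.
  by under eq_integral do rewrite big_nil; rewrite integral0 big_nil.
have [a0 mA] := hs (a, A) (mem_head _ _).
have hs' p : p \in s -> 0 <= p.1 /\ measurable p.2.
  by move=> ps; apply: hs; rewrite inE ps orbT.
have ge0s w : 0 <= \sum_(p <- s) p.1 * \1_(p.2) w :> R.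
  by rewrite big_seq sumr_ge0// => p /hs'[p0 _]; rewrite mulr_ge0.
have ms := measurable_comb_indic _ hs'.
under eq_integral do rewrite big_cons EFinD EFinM.
rewrite ge0_integralD//=; last 4 first.
- by move=> w _; rewrite -EFinM lee_fin mulr_ge0.
- by apply/measurable_EFinP; apply: measurable_funM => //; exact: measurable_indic.
- by move=> w _; rewrite lee_fin.
- exact/measurable_EFinP.
rewrite IH// big_cons EFinD EFinM ge0_integralZl_EFin//; last first.
  by apply/measurable_EFinP; exact: measurable_indic.
by rewrite integral_indic// setIT EFin_prb.
Qed.

Lemma le_comb_prb (s t : seq (R * set T)) : nonneg_comb s -> nonneg_comb t ->
  (forall w, \sum_(p <- s) p.1 * \1_(p.2) w <= \sum_(p <- t) p.1 * \1_(p.2) w :> R) ->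
  \sum_(p <- s) p.1 * prb P p.2 <= \sum_(p <- t) p.1 * prb P p.2.
Proof.
move=> hs ht st; rewrite -lee_fin -!integral_comb_indic//.
have ge0 u : nonneg_comb u ->
    forall w, (0 <= (\sum_(p <- u) p.1 * \1_(p.2) w : R)%:E)%E.
  move=> hu w; rewrite lee_fin big_seq sumr_ge0// => p /hu[p0 _].
  by rewrite mulr_ge0.
apply: ge0_le_integral => //.
- by move=> w _; exact: ge0.
- by apply/measurable_EFinP; exact: measurable_comb_indic.
- by apply/measurable_EFinP; exact: measurable_comb_indic.
- by move=> w _; rewrite lee_fin.
Qed.

(** The second moment of the hit count is at most n + q^2 n^2, so the hit frequency has variance at
    most 1/n. *)
Lemma weak_law q A (n : nat) (delta : R) : iid_events P q A -> 0 <= q ->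
  (0 < n)%N -> 0 < delta ->
  let dev w := `|n%:R^-1 * (\sum_(i < n) \1_(A i) w) - q| in
  measurable [set w | delta <= dev w] /\
  prb P [set w | delta <= dev w] <= (n%:R * delta ^+ 2)^-1.
Proof.
move=> iidA q0 n0 dl0 dev.
have mA := iidA.1.
set bad := [set w | _].
have mbad : measurable bad.
  rewrite /bad -[X in measurable X]setTI; apply: measurable_fun_le => //.
  apply: measurableT_comp => //; apply: measurable_funB => //.
  apply: measurable_funM => //; apply: measurable_sum => i.
  exact: measurable_indic.
split => //.
(* With S the number of hits, d^2 n^2 1_bad + 2 q n S <= q^2 n^2 + S^2 holds
   pointwise, and both sides are nonnegative combinations of indicators. *)
pose s := (delta ^+ 2 * n%:R ^+ 2, bad) ::
  [seq (2 * q * n%:R, A i) | i <- iota 0 n].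
pose t := (q ^+ 2 * n%:R ^+ 2, setT : set T) ::
  [seq (1, A ij.1 `&` A ij.2) | ij <- allpairs pair (iota 0 n) (iota 0 n)].
have : \sum_(p <- s) p.1 * prb P p.2 <= \sum_(p <- t) p.1 * prb P p.2.
  apply: le_comb_prb => [p|p|w].
  - rewrite inE => /orP[/eqP ->|/mapP[i _ ->]]//=.
      by rewrite mulr_ge0 ?sqr_ge0.
    by rewrite !mulr_ge0.
  - rewrite inE => /orP[/eqP ->|/mapP[[i j] _ ->]]//=.
      by rewrite mulr_ge0 ?sqr_ge0.
    by split => //; exact: measurableI.
  - rewrite !big_cons !big_map/= big_allpairs/= indicT.
    have -> : \sum_(i <- iota 0 n) \sum_(j <- iota 0 n)
        1 * \1_(A i `&` A j) w = (\sum_(i < n) \1_(A i) w) ^+ 2 :> R.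
      rewrite expr2 mulr_suml -[in RHS](big_mkord predT (fun i => \1_(A i) w * _)).
      rewrite /index_iota subn0; apply: eq_bigr => i _.
      rewrite -(big_mkord predT (fun i => \1_(A i) w)) /index_iota subn0 mulr_sumr.
      by apply: eq_bigr => j _; rewrite mul1r indicI.
    rewrite -mulr_sumr -(big_mkord predT (fun i => \1_(A i) w)) /index_iota subn0.
    set S := \sum_(i <- _) _.
    have devE : n%:R ^+ 2 * dev w ^+ 2 = (S - q * n%:R) ^+ 2.
      rewrite /dev -normrX ger0_norm ?sqr_ge0// -exprMn mulrBr mulrA divff ?pnatr_eq0 -?lt0n//.
      by rewrite -(big_mkord predT (fun i => \1_(A i) w)) /index_iota subn0 mul1r mulrC.
    suff : delta ^+ 2 * n%:R ^+ 2 * \1_bad w <= (S - q * n%:R) ^+ 2.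
      by move=> h; rewrite /=; nra.
    rewrite -devE indicE; have [/set_mem bw|_] := boolP (w \in bad).
      rewrite mulr1 mulrC ler_wpM2l ?sqr_ge0// lerXn2r ?nnegrE//; first exact: ltW.
      exact: normr_ge0.
    by rewrite mulr0 mulr_ge0 ?sqr_ge0.
rewrite !big_cons !big_map/= big_allpairs/=.
have sumA : \sum_(i <- iota 0 n) 2 * q * n%:R * prb P (A i) = 2 * q ^+ 2 * n%:R ^+ 2.
  under eq_bigr do rewrite (iid_events1 _ _ _ _ iidA).
  rewrite big_const_seq count_predT size_iota iter_addr addr0 -[LHS]mulr_natl; ring.
(* Each of the n diagonal terms is at most 1; each off-diagonal term equals q^2 by pairwise
   independence. *)
have sumAA : \sum_(i <- iota 0 n) \sum_(j <- iota 0 n) 1 * prb P (A i `&` A j) <=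
    n%:R + q ^+ 2 * n%:R ^+ 2.
  apply: (@le_trans _ _ (\sum_(i <- iota 0 n) (1 + q ^+ 2 * n%:R))).
    rewrite big_seq [leRHS]big_seq; apply: ler_sum => i iin.
    rewrite (bigD1_seq i)//= ?iota_uniq// lerD//.
      by rewrite mul1r prb_le1//; exact: measurableI.
    apply: (@le_trans _ _ (\sum_(j <- iota 0 n | j != i) q ^+ 2)).
      by apply: ler_sum => j ji; rewrite mul1r (iid_events2 _ _ _ _ _ iidA)// eq_sym.
    rewrite big_const_seq iter_addr addr0 -[leLHS]mulr_natr ler_wpM2l ?sqr_ge0//.
    by rewrite ler_nat (leq_trans (count_size _ _))// size_iota.
  rewrite big_const_seq count_predT size_iota iter_addr addr0 -[leLHS]mulr_natl.
  by rewrite mulrDr mulr1 mulrCA -expr2.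
have -> : prb P setT = 1 by rewrite /prb probability_setT.
rewrite sumA mulr1 => /le_trans - /(_ _ (lerD (lexx _) sumAA)) h.
have nR : 0 < n%:R :> R by rewrite ltr0n.
rewrite -[leRHS]mul1r ler_pdivlMr ?mulr_gt0 ?exprn_gt0//.
rewrite -(ler_pM2l nR) mulr1.
rewrite [leLHS](_ : _ = delta ^+ 2 * n%:R ^+ 2 * prb P bad); last by ring.
lra.
Qed.
End weak_law.

(** * Numerical estimates for the union bound over k *)

Lemma sum_inv_sq_le2 (R : realFieldType) (N : nat) :
  \sum_(k < N) (k.+1%:R ^+ 2)^-1 <= 2 :> R.
Proof.
(* The subtracted inverse lets the induction telescope: 1/(x+1)^2 <= 1/x - 1/(x+1), with gap 1/(x
   (x+1)^2). *)
have h M : \sum_(k < M.+1) (k.+1%:R ^+ 2)^-1 <= 2 - M.+1%:R^-1 :> R.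
  elim: M => [|M IH]; first by rewrite big_ord1 expr1n invr1; lra.
  rewrite big_ord_recr/=; apply: le_trans (lerD IH (lexx _)) _.
  have M0 : 0 < M.+1%:R :> R by rewrite ltr0n.
  rewrite -(natr1 M.+1); move: M0; move: (M.+1%:R) => x x0.
  have x10 : 0 < x + 1 by lra.
  rewrite -subr_ge0 [leRHS](_ : _ = (x * (x + 1) ^+ 2)^-1).
    by rewrite invr_ge0 mulr_ge0 ?sqr_ge0// ltW.
  by field; rewrite !gt_eqF.
case: N => [|N]; first by rewrite big_ord0.
by apply: (le_trans (h N)); rewrite gerBl invr_ge0.
Qed.

(** Condition (2) in exponential form: since p k < 1, the constant [C] may be raised to an integer
    [L], and exponentiating gives the claim. Taking [L] positive settles p k = 0, the case log(1/0)
    = oo, because then 0^L = 0. *)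
Lemma ln_ratio_pow (R : realType) (p : nat -> R) (C : R) :
  (forall k, 0 <= p k < 1) ->
  (forall k, 0 < p k -> ln k.+1%:R <= C * ln (p k)^-1) ->
  exists L : nat, (0 < L)%N /\ forall k, k.+1%:R * p k ^+ L <= 1.
Proof.
move=> p01 hC; exists (Num.truncn C).+1; split => // k.
have /andP[] := p01 k; rewrite le_eqVlt => /orP[/eqP <- _|p0 p1].
  by rewrite expr0n/= mulr0.
have lnp0 : 0 < ln (p k)^-1 by rewrite lnV ?posrE// oppr_gt0 ln_lt0// p0.
have k0 : 0 < k.+1%:R :> R by rewrite ltr0n.
have pL : 0 < p k ^+ (Num.truncn C).+1 by rewrite exprn_gt0.
rewrite -ler_ln ?posrE ?mulr_gt0// ln1 lnM ?posrE// lnXn//.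
have := hC k p0; rewrite lnV ?posrE// -mulr_natl => h.
have : C * - ln (p k) <= (Num.truncn C).+1%:R * - ln (p k).
  by rewrite ler_wpM2r ?ltW ?truncnS_gt// -lnV ?posrE.
rewrite -lnV ?posrE//.
move: h; rewrite lnV ?posrE//; lra.
Qed.

(** Split q^m as q^(4L) q^(m-4L). The first factor is at most 1/(k+1)^2, by squaring the hypothesis,
    and makes the bound summable in k. The second is at most 2^((M+1)(4L-m)), which beats 2^n <=
    2^(M m) by a factor 2^m up to a constant. *)
Lemma binomial_tail_le (R : realFieldType) (q : R) (M m n L k : nat) :
  0 <= q -> q <= (2 ^+ M.+1)^-1 -> k.+1%:R * q ^+ (2 * L) <= 1 ->
  (n <= M * m)%N -> (4 * L <= m)%N ->
  2 ^+ n * q ^+ m <= (k.+1%:R ^+ 2)^-1 * ((2 ^+ M.+1) ^+ (4 * L) / 2 ^+ m).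
Proof.
move=> q0 qM kq nMm Lm.
have k0 : 0 < k.+1%:R :> R by rewrite ltr0n.
have q4 : q ^+ (4 * L) <= (k.+1%:R ^+ 2)^-1.
  rewrite -[leRHS]mul1r ler_pdivlMr ?exprn_gt0//.
  rewrite (_ : 4 * L = 2 * L * 2)%N; last by rewrite mulnAC.
  rewrite exprM -exprMn mulrC exprn_ile1// mulr_ge0 ?exprn_ge0//.
have a0 : 0 < 2 ^+ M.+1 :> R by rewrite exprn_gt0.
have qa : q ^+ (m - 4 * L) <= (2 ^+ M.+1) ^+ (4 * L) / (2 ^+ M.+1) ^+ m.
  have qi : q ^+ (m - 4 * L) <= ((2 ^+ M.+1)^-1) ^+ (m - 4 * L).
    by rewrite lerXn2r ?nnegrE// invr_ge0 ltW.
  rewrite (le_trans qi)// exprVn -(subnKC Lm) exprD subnKC//.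
  by rewrite invfM mulrA divff ?mul1r// expf_neq0// gt_eqF.
rewrite -[in leLHS](subnKC Lm) exprD.
have n2 : 2 ^+ n <= 2 ^+ (M * m) :> R by rewrite ler_weXn2l// ler1n.
rewrite mulrCA; apply: ler_pM; rewrite ?exprn_ge0//.
  by rewrite mulr_ge0// exprn_ge0.
apply: (le_trans (ler_pM _ _ n2 qa)); rewrite ?exprn_ge0//.
rewrite -[in leLHS](exprM 2 M.+1 m) (mulSn M m) (exprD _ m).
rewrite le_eqVlt; apply/orP; left; apply/eqP.
have x0 : 2 ^+ m != 0 :> R by rewrite expf_neq0.
have y0 : 2 ^+ (M * m) != 0 :> R by rewrite expf_neq0.
move: x0 y0; move: (2 ^+ m) (2 ^+ (M * m)) ((2 ^+ M.+1) ^+ (4 * L)) => x y z x0 y0.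
by field; rewrite x0 y0.
Qed.

(** * Measurability with respect to cylinders *)

Lemma cylinder_coord (j : nat) : cyl_measurable [set f | f j].
Proof.
apply: sub_sigma_algebra; exists j => //; exists [set true] => //.
by rewrite setTI; apply/seteqP; split=> f /=; case: (f j).
Qed.

Lemma measurable_to_cylinders {d} {T : measurableType d} (Y : T -> nat -> bool) :
  (forall j, measurable_fun setT (fun w => Y w j)) ->
  measurable_fun setT (Y : T -> g_sigma_algebraType cylinders).
Proof.
move=> mY; apply: (@measurability _ _ T (g_sigma_algebraType cylinders) setT Y cylinders) => //.
move=> _ [_ [j _ [C mC <-]] <-]; rewrite !setTI.
by rewrite -[X in measurable X]setTI; exact: mY.
Qed.

(** * The samples: bad events and the bound on [Delta] *)

Section samples.
Context {R : realType} {d d'} {T : measurableType d} {T' : measurableType d'}.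
Context (P : probability T R) (X : nat -> T -> bool).
Context (P' : probability T' R) (Y : nat -> T' -> nat -> bool).
Hypothesis mX : forall i, measurable_fun [set: T] (X i).
Hypothesis iidY : iid_samples P X P' Y.

Let mvecX : measurable_fun setT (vec X : T -> g_sigma_algebraType cylinders).
Proof. exact: measurable_to_cylinders. Qed.

Let mY i : measurable_fun setT (Y i : T' -> g_sigma_algebraType cylinders).
Proof. by have [mY _ _] := iidY; exact: measurable_to_cylinders. Qed.

Let measurable_vecX B : cyl_measurable B -> measurable (vec X @^-1` B).
Proof. by move=> mB; rewrite -[X in measurable X]setTI; exact: mvecX. Qed.

Let measurable_Y i B : cyl_measurable B -> measurable (Y i @^-1` B).
Proof. by move=> mB; rewrite -[X in measurable X]setTI; exact: mY. Qed.

Lemma prb_samples i B : cyl_measurable B ->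
  prb P' (Y i @^-1` B) = prb P (vec X @^-1` B).
Proof. by move=> mB; have [_ sl _] := iidY; rewrite /prb sl. Qed.

Lemma iid_events_samples B : cyl_measurable B ->
  iid_events P' (prb P (vec X @^-1` B)) (fun i => Y i @^-1` B).
Proof.
move=> mB; split=> [i|I uI]; first exact: measurable_Y.
have [_ _ indY] := iidY; rewrite (indY I (fun=> B))//.
under eq_bigr do rewrite prb_samples//.
by rewrite big_const_seq count_predT iter_mulr_1.
Qed.

Definition dev (n : nat) (w : T') (j : nat) : R :=
  `| n%:R^-1 * (\sum_(i < n) ((Y i w j : nat)%:R)) - meanX P X j |.

Let indic_coord i j w : \1_(Y i @^-1` [set f | f j]) w = (Y i w j : nat)%:R :> R.
Proof.
rewrite indicE; congr (nat_of_bool _)%:R.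
by apply/idP/idP => [/set_mem//|?]; exact/mem_set.
Qed.

Lemma measurable_dev n j : measurable_fun setT (fun w => dev n w j).
Proof.
rewrite /dev; apply: measurableT_comp => //; apply: measurable_funB => //.
apply: measurable_funM => //; apply: measurable_sum => i.
under eq_fun do rewrite -indic_coord.
by apply: measurable_indic; apply: measurable_Y; exact: cylinder_coord.
Qed.

(** Every deviation is at most 1, so the supremum is at most c plus the indicator of [Bad], which
    integrates to at most c + b. *)
Lemma Delta_le n (Bad : set T') (b c : R) : 0 <= c -> measurable Bad ->
  prb P' Bad <= b -> (forall w, ~ Bad w -> forall j, dev n w j <= c) ->
  (Delta P X P' Y n <= (c + b)%:E)%E.
Proof.
move=> c0 mBad Badb devc.
have dev1 w j : dev n w j <= 1.
  have m0 : 0 <= meanX P X j by exact: prb_ge0.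
  have m1 : meanX P X j <= 1.
    apply: prb_le1; have := measurable_vecX _ (cylinder_coord j); exact.
  (* For n = 0 the empirical mean is 0 and the deviation is the true mean. *)
  have [n0|n0] := posnP n.
    by rewrite /dev n0 big_ord0 mulr0 sub0r normrN ger0_norm.
  rewrite /dev ler_norml.
  have e0 : 0 <= n%:R^-1 * (\sum_(i < n) ((Y i w j : nat)%:R)) :> R.
    by rewrite mulr_ge0// sumr_ge0.
  have e1 : n%:R^-1 * (\sum_(i < n) ((Y i w j : nat)%:R)) <= 1 :> R.
    rewrite mulrC ler_pdivrMr ?ltr0n// mul1r -natr_sum ler_nat.
    rewrite -[leqRHS]card_ord -sum1_card; apply: leq_sum => i _.
    by case: (Y i w j).
  by apply/andP; split; lra.
rewrite (@le_trans _ _ (\int[P']_w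
    (\sum_(p <- [:: (c, setT); (1, Bad)]) p.1 * \1_(p.2) w)%:E)%E)//; last first.
  rewrite integral_comb_indic; last first.
    by move=> p; rewrite !inE => /orP[]/eqP -> /=; split.
  rewrite lee_fin !big_cons big_nil/= addr0 mul1r lerD//.
  by rewrite /prb probability_setT mulr1.
have hcomb : forall p, p \in [:: (c, [set: T']); (1, Bad)] -> 0 <= p.1 /\ measurable p.2.
  by move=> p; rewrite !inE => /orP[]/eqP -> /=; split.
apply: ge0_le_integral => //.
- move=> w _; apply: (@le_trans _ _ (dev n w 0)%:E); first by rewrite lee_fin normr_ge0.
  by apply: ereal_sup_ubound; exists 0%N.
(* The supremum over all coordinates is the tail supremum from rank 0, hence measurable. *)
- rewrite (_ : (fun w => _) = (fun w => esups (fun j => (dev n w j)%:E) 0%N)); last first.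
    apply/funext => w; rewrite /esups; congr ereal_sup.
    by apply/seteqP; split=> [_ [j _ <-]|_ [j _ <-]]; exists j.
  apply: measurable_fun_esups => // j.
  exact/measurable_EFinP/measurable_dev.
- by apply/measurable_EFinP; exact: measurable_comb_indic.
- move=> w _; apply: ge_ereal_sup => _ [j _ <-]; rewrite lee_fin.
  rewrite !big_cons big_nil/= addr0 mul1r indicT/= mulr1.
  have [Badw|/negP nBad] := boolP (w \in Bad).
    by rewrite indicE Badw; apply: (le_trans (dev1 w j)); rewrite lerDr.
  rewrite indicE (negbTE (introN idP nBad)) addr0; apply: devc => Bw.
  by apply: nBad; exact/mem_set.
Qed.


(** The three terms of the final bound compare the empirical means at i and at its representative j,
    the empirical and true means at j, and the true means at j and at i. [G] does not depend on
    n. *)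
Lemma exists_bad_event (E : nat -> set T) (J : seq nat) (K M : nat)
    (eps delta C : R) :
  (0 < K)%N -> (0 < M)%N -> 0 < delta -> (forall k, measurable (E k)) ->
  (forall k, prb P (E k) <= eps) ->
  (2 * K)%:R * eps <= (2 ^+ M.+1)^-1 -> (2 * K)%:R ^+ 2 * eps <= 1 ->
  (forall k, 0 < prb P (E k) -> ln (k.+1%:R) <= C * ln (prb P (E k))^-1) ->
  (forall i, exists2 j, j \in J & exists Ks : seq nat, (size Ks <= K)%N /\
     [set w | X i w != X j w] `<=` \bigcup_(k in [set k | k \in Ks]) E k) ->
  exists (G : R) (N : nat), forall n, (N <= n)%N -> (0 < n)%N ->
    exists Bad : set T', [/\ measurable Bad, prb P' Bad <= G / n%:R &
      forall w, ~ Bad w -> forall i,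
        dev n w i <= K%:R / M%:R + delta + K%:R * eps].
Proof.
move=> K0 M0 dl0 mE Eeps eps2K eps2K2 lnE coverE.
have [B [mB qB traceB]] := exists_traces P _ E K mvecX mE K0.
pose q k := prb P (vec X @^-1` B k).
have K2 : 1 <= (2 * K)%:R :> R by rewrite ler1n muln_gt0.
have eps0 : 0 <= eps by exact: le_trans (prb_ge0 P (E 0%N)) (Eeps _).
have p01 k : 0 <= prb P (E k) < 1.
  rewrite prb_ge0/=; apply: (le_lt_trans (Eeps k)).
  apply: (@le_lt_trans _ _ ((2 * K)%:R * eps)); first by rewrite ler_peMl.
  by rewrite (le_lt_trans eps2K)// invf_lt1 ?exprn_gt0// exprn_egt1// ltr1n.
have [L [L0 pL]] := ln_ratio_pow _ _ _ p01 lnE.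
have q0 k : 0 <= q k by exact: prb_ge0.
have qM k : q k <= (2 ^+ M.+1)^-1.
  by apply: (le_trans (qB k)); apply: le_trans eps2K; rewrite ler_wpM2l.
have q1 k : 0 <= q k <= 1.
  by rewrite q0 prb_le1//; apply: measurable_vecX; exact: mB.
(* Passing from E_k to B_k costs a factor 2K, which squaring absorbs: q^2 <= (2K)^2 p^2 <= (2K)^2
   eps p <= p. Hence the doubled exponent. *)
have qL k : k.+1%:R * q k ^+ (2 * L) <= 1.
  apply: le_trans (pL k); rewrite ler_wpM2l// exprM lerXn2r ?nnegrE ?exprn_ge0//.
    exact: prb_ge0.
  apply: (@le_trans _ _ (((2 * K)%:R * prb P (E k)) ^+ 2)).
    rewrite lerXn2r ?nnegrE// ?mulr_ge0 ?prb_ge0//; exact: qB.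
  rewrite exprMn [_ ^+ 2 in X in _ * X]expr2 mulrA ler_piMl ?prb_ge0//.
  by apply: le_trans eps2K2; rewrite ler_wpM2l ?sqr_ge0.
(* The representative and the index list are chosen once for all i, so that the uncovered null sets
   [Z i] below form a countable family. *)
have [jK jKP] := choice (fun i => let: ex_intro2 j jJ (ex_intro Ks h) := coverE i in
  ex_intro (fun jK : nat * seq nat => [/\ jK.1 \in J, (size jK.2 <= K)%N &
    [set w | X i w != X jK.1 w] `<=` \bigcup_(k in [set k | k \in jK.2]) E k])
    (j, Ks) (And3 jJ h.1 h.2)).
pose D i := [set f : nat -> bool | f i != f (jK i).1].
have mD i : cyl_measurable (D i).
  have -> : D i = ([set f | f i] `\` [set f | f (jK i).1]) `|`
      ([set f | f (jK i).1] `\` [set f | f i]).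
    apply/seteqP; split=> f; rewrite /D /=.
      by case: (f i); case: (f _) => //= _; [left|right].
    by case: (f i); case: (f _) => //= -[] [].
  by apply: (@measurableU _ (g_sigma_algebraType cylinders));
    apply: (@measurableD _ (g_sigma_algebraType cylinders)); exact: cylinder_coord.
pose Z i := D i `\` \bigcup_(k in [set k | k \in (jK i).2]) B k.
have mZ i : cyl_measurable (Z i).
  apply: (@measurableD _ (g_sigma_algebraType cylinders)); first exact: mD.
  by apply: bigcup_measurable => k _; exact: mB.
have Z0 i : prb P (vec X @^-1` Z i) = 0.
  by have [_ sK DE] := jKP i; exact: (traceB (D i) (jK i).2 (mD i) sK DE).
pose a : R := (2 ^+ M.+1) ^+ (4 * L).
have a0 : 0 < a by rewrite /a !exprn_gt0.
(* In the first term, 2 bounds the sum of 1/(k+1)^2, [a] comes from [binomial_tail_le], and M from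
   2^-m <= M/n. The second term is Chebyshev's bound summed over [J]. The threshold on n ensures 4L
   <= m. *)
exists (2 * a * M%:R + (size J)%:R / delta ^+ 2), (4 * L * M)%N => n Nn n0.
have nR : 0 < n%:R :> R by rewrite ltr0n.
(* The successor gives n <= M m, while fewer than m hits still means at most n/M of them. *)
pose m := (n %/ M).+1.
have nMm : (n <= M * m)%N by rewrite mulnC ltnW// ltn_ceil.
have Lm : (4 * L <= m)%N by rewrite leqW// leq_divRL.
pose hits k w := (\sum_(i < n) (w \in Y i @^-1` B k))%N.
pose H k := [set w | (m <= hits k w)%N].
have mH k : measurable (H k).
  by have [] := prb_many_hits _ _ _ n m (iid_events_samples _ (mB k)) (q1 k).
have PH k : prb P' (H k) <= 2 ^+ n * q k ^+ m.
  by have [] := prb_many_hits _ _ _ n m (iid_events_samples _ (mB k)) (q1 k).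
have mUH : measurable (\bigcup_k H k) by exact: bigcup_measurable.
have PUH : prb P' (\bigcup_k H k) <= 2 * a * M%:R / n%:R.
  apply: prb_bigcup_le => // N.
  apply: (@le_trans _ _ (\sum_(k < N) (k.+1%:R ^+ 2)^-1 * (a / 2 ^+ m))).
    apply: ler_sum => k _; apply: (le_trans (PH k)).
    exact: binomial_tail_le.
  rewrite -mulr_suml; apply: (@le_trans _ _ (2 * (a / 2 ^+ m))).
    rewrite ler_wpM2r ?sum_inv_sq_le2// mulr_ge0 ?(ltW a0)// invr_ge0 exprn_ge0//.
  rewrite -!mulrA ler_wpM2l// ler_wpM2l ?(ltW a0)//.
  rewrite ler_pdivlMr// mulrC ler_pdivrMr ?exprn_gt0//.
  rewrite -natrX -natrM ler_nat (leq_trans nMm)// leq_mul2l ltnW ?orbT//.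
  exact: ltn_expl.
pose W j := [set w | delta <= dev n w j].
have mPW j : measurable (W j) /\ prb P' (W j) <= (n%:R * delta ^+ 2)^-1.
  have := weak_law P' _ _ n delta (iid_events_samples _ (cylinder_coord j))
    (prb_ge0 P _) n0 dl0.
  rewrite /=; under eq_set do under eq_bigr do rewrite indic_coord.
  exact.
have mUW : measurable (\bigcup_(j in [set j | j \in J]) W j).
  by apply: bigcup_measurable => j _; have [] := mPW j.
have PUW : prb P' (\bigcup_(j in [set j | j \in J]) W j) <=
    (size J)%:R / delta ^+ 2 / n%:R.
  apply: (le_trans (prb_sub_bigcup_seq P' _ J W _ mUW (fun j => (mPW j).1) _)) => //.
  apply: (@le_trans _ _ (\sum_(j <- J) (n%:R * delta ^+ 2)^-1)).
    by apply: ler_sum => j _; have [] := mPW j.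
  by rewrite big_const_seq count_predT iter_addr addr0 -[leLHS]mulr_natl invfM mulrAC mulrA.
(* Some sample falls in an uncovered set: a countable union of null events. *)
pose V := \bigcup_s \bigcup_i Y s @^-1` Z i.
have mV' s : measurable (\bigcup_i Y s @^-1` Z i).
  by apply: bigcup_measurable => i _; exact: measurable_Y.
have mV : measurable V by apply: bigcup_measurable => s _.
have PV : prb P' V = 0.
  apply: prb_bigcup0 => // s; apply: prb_bigcup0 => i; first exact: measurable_Y.
  by rewrite prb_samples.
exists (\bigcup_k H k `|` \bigcup_(j in [set j | j \in J]) W j `|` V); split.
- by apply: measurableU => //; exact: measurableU.
- apply: (le_trans (prb_setU_le _ _ _ _ mV)); first exact: measurableU.
  rewrite PV addr0; apply: (le_trans (prb_setU_le _ _ _ mUH mUW)).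
  by rewrite mulrDl lerD.
move=> w nBad i.
have nH k : ~ H k w by move=> Hk; apply: nBad; left; left; exists k.
have nW j : j \in J -> ~ W j w by move=> jJ Wj; apply: nBad; left; right; exists j.
have nZ s : ~ Z i (Y s w) by move=> Zs; apply: nBad; right; exists s => //; exists i.
have := jKP i; set j := (jK i).1; set Ks := (jK i).2 => -[jJ sK cover_ij].
pose emp l : R := n%:R^-1 * (\sum_(s < n) ((Y s w l : nat)%:R)).
have emp_ij : `|emp i - emp j| <= K%:R / M%:R.
  rewrite /emp -mulrBr -sumrB normrM ger0_norm ?invr_ge0//.
  rewrite mulrC ler_pdivrMr//.
  (* A sample that separates i from j avoids [Z i], so it hits some B_k with k in [Ks]. Exchanging
     the sums leaves at most K hit counts, each at most n/M. *)
  apply: (@le_trans _ _ (\sum_(s < n) \sum_(k <- Ks) (w \in Y s @^-1` B k : nat)%:R)).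
    apply: (le_trans (ler_norm_sum _ _ _)); apply: ler_sum => s _.
    have [ij|ij] := eqVneq (Y s w i) (Y s w j).
      by rewrite ij subrr normr0 sumr_ge0.
    have [k kKs Bk] : (\bigcup_(k in [set k | k \in Ks]) B k) (Y s w).
      by apply: contrapT => nB; apply: (nZ s); split.
    apply: (@le_trans _ _ 1).
      by case: (Y s w i); case: (Y s w j); rewrite ?subrr ?subr0 ?sub0r ?normrN ?normr0 ?normr1.
    have /= kin : k \in Ks := kKs.
    by rewrite (big_rem k)//= mem_set// lerDl sumr_ge0.
  rewrite exchange_big/=.
  apply: (@le_trans _ _ (\sum_(k <- Ks) (n %/ M)%:R)).
    apply: ler_sum => k _; rewrite -natr_sum ler_nat.
    by have /negP := nH k; rewrite -ltnNge ltnS.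
  rewrite big_const_seq count_predT iter_addr addr0 -[leLHS]mulr_natl.
  apply: (@le_trans _ _ (K%:R * (n %/ M)%:R)); first by rewrite ler_wpM2r// ler_nat.
  rewrite -mulrA ler_wpM2l// mulrC ler_pdivlMr ?ltr0n// -natrM ler_nat.
  exact: leq_divM.
have mcoord l : measurable [set u | X l u].
  by have := measurable_vecX _ (cylinder_coord l); exact.
have mneq : measurable [set u | X i u != X j u].
  by have := measurable_vecX _ (mD i); exact.
have mean_ij : `|meanX P X j - meanX P X i| <= K%:R * eps.
  rewrite distrC.
  apply: (@le_trans _ _ (prb P [set u | X i u != X j u])).
    by apply: dist_prb_le => // u /=; case: (X i u); case: (X j u); auto.
  apply: (le_trans (prb_sub_bigcup_seq _ _ Ks E _ mneq mE cover_ij)).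
  apply: (@le_trans _ _ (\sum_(k <- Ks) eps)); first by apply: ler_sum.
  rewrite big_const_seq count_predT iter_addr addr0 -[leLHS]mulr_natl.
  by rewrite ler_wpM2r// ler_nat.
have dev_j : dev n w j <= delta by rewrite leNgt; apply/negP => /ltW; exact: nW.
have -> : dev n w i = `|(emp i - emp j) + (emp j - meanX P X j) +
    (meanX P X j - meanX P X i)|.
  by rewrite /dev; congr `|_|; rewrite /emp; lra.
apply: (le_trans (ler_normD _ _)); apply: lerD => //.
by apply: (le_trans (ler_normD _ _)); apply: lerD.
Qed.

End samples.

(** * Choice of parameters and convergence *)

Lemma Delta_ge0 {R : realType} {d} {T : measurableType d} (P : probability T R)
    (X : nat -> T -> bool) {d'} {T' : measurableType d'} (P' : probability T' R)
    (Y : nat -> T' -> nat -> bool) (n : nat) :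
  (0 <= Delta P X P' Y n)%E.
Proof.
apply: integral_ge0 => w _.
apply: (@le_trans _ _ (dev P X Y n w 0)%:E); first by rewrite lee_fin normr_ge0.
by apply: ereal_sup_ubound; exists 0%N.
Qed.

Theorem theorem9 (R : realType) (d : measure_display) (Omega : measurableType d)
  (P : probability Omega R) (X : nat -> Omega -> bool) :
  (forall i, measurable_fun [set: Omega] (X i)) ->
  totally_bounded_xi P X ->
  (exists K : nat, (1 <= K)%N /\
     forall eps : R, 0 < eps ->
       exists (E : nat -> set Omega) (J : seq nat),
         [/\ forall k, measurable (E k),
             (* (1) *) forall k, prb P (E k) <= eps,
             (* (2) sup_k log(k+1) / log(1/P(E_k)) < oo, with log(1/0) = oo *)
             (exists C : R, forall k, 0 < prb P (E k) ->
                 ln (k.+1%:R) <= C * ln (prb P (E k))^-1) &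
             (* (3) *)
             forall i : nat, exists2 j, j \in J &
               exists Ks : seq nat, (size Ks <= K)%N /\
                 [set w | X i w != X j w] `<=`
                   \bigcup_(k in [set k | k \in Ks]) E k]) ->
  forall (d' : measure_display) (Omega' : measurableType d')
         (P' : probability Omega' R) (Y : nat -> Omega' -> nat -> bool),
    iid_samples P X P' Y ->
    (Delta P X P' Y n @[n --> \oo] --> 0%E).
Proof.
move=> mX _ [K [K0 coverE]] d' Omega' P' Y iidY.
(* With the whole space as bad event, [Delta_le] gives the bound 1, so the limit can be taken among
   the reals. *)
have fin_Delta n : Delta P X P' Y n \is a fin_num.
  rewrite ge0_fin_numE ?Delta_ge0//.
  have /le_lt_trans -> // : (Delta P X P' Y n <= (0 + 1)%:E)%E.
    by apply: (Delta_le P X P' Y mX iidY n setT) => // [|w /(_ I)//]; exact: prb_le1.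
  by rewrite ltry.
have -> : (fun n => Delta P X P' Y n) = EFin \o (fun n => fine (Delta P X P' Y n)).
  by apply/funext => n /=; rewrite fineK.
apply: cvg_EFin; first exact: nearW.
apply/cvgrPdist_le => e e0.
have KR : 0 < K%:R :> R by rewrite ltr0n.
(* The final bound has four terms, K/M, delta, K eps and G/n, each made at most e/5. [M] is fixed
   first because eps depends on it, and n comes last because [G] depends on both. *)
pose M := (Num.truncn (5 * K%:R / e)).+1.
have KM : K%:R / M%:R <= e / 5.
  have : 5 * K%:R / e <= M%:R by rewrite ltW// truncnS_gt.
  by rewrite !ler_pdivrMr ?ltr0n//; lra.
(* The three entries give, in order, K eps <= e/5 and the two smallness conditions of
   [exists_bad_event]. *)
pose eps := Num.min (e / 5 / K%:R) (Num.min ((2 ^+ M.+1)^-1 / (2 * K)%:R)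
  ((2 * K)%:R ^+ 2)^-1).
have K2 : 0 < (2 * K)%:R :> R by rewrite ltr0n muln_gt0.
have eps0 : 0 < eps.
  by rewrite !lt_min !divr_gt0 ?invr_gt0 ?exprn_gt0.
have eps1 : K%:R * eps <= e / 5.
  by rewrite mulrC -ler_pdivlMr// ge_min lexx.
have eps2 : (2 * K)%:R * eps <= (2 ^+ M.+1)^-1.
  by rewrite mulrC -ler_pdivlMr// !ge_min lexx orbT.
have eps3 : (2 * K)%:R ^+ 2 * eps <= 1.
  by rewrite mulrC -ler_pdivlMr ?exprn_gt0// div1r !ge_min lexx !orbT.
have [E [J [mE Eeps [C lnE] cover]]] := coverE eps eps0.
have e5 : 0 < e / 5 by lra.
have [G [N bad]] := exists_bad_event P X P' Y mX iidY E J K M eps (e / 5) C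
  K0 (ltn0Sn _) e5 mE Eeps eps2 eps3 lnE cover.
near=> n.
have n0 : (0 < n)%N by near: n; exists 1%N.
have Nn : (N <= n)%N by near: n; exists N.
have nR : 0 < n%:R :> R by rewrite ltr0n.
have Gn : G / n%:R <= e / 5.
  have : 5 * G / e <= n%:R.
    apply: (@le_trans _ _ (Num.truncn (5 * G / e)).+1%:R).
      by rewrite ltW// truncnS_gt.
    by rewrite ler_nat; near: n; exists (Num.truncn (5 * G / e)).+1.
  by rewrite !ler_pdivrMr//; lra.
have [Bad [mBad PBad devBad]] := bad n Nn n0.
rewrite /= sub0r normrN ger0_norm ?fine_ge0 ?Delta_ge0//.
rewrite -lee_fin fineK//.
have c0 : 0 <= K%:R / M%:R + e / 5 + K%:R * eps.
  by rewrite !addr_ge0 ?divr_ge0 ?mulr_ge0 ?ltW.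
apply: (le_trans (Delta_le P X P' Y mX iidY n Bad _ _ c0 mBad PBad devBad)).
by rewrite lee_fin; lra.
Unshelve. all: by end_near. Qed.
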